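(* Let $\Gamma$ be the graph specified in the context, i.e. the disjoint union of one folded component and $\frac12\left(\frac{h(-p)}{\mathrm{ord}(\ell)}-1\right)$ stacked components. Then $$\mathrm{MeanDiam}(\Gamma)=\frac12\left(\mathrm{ord}(\ell)+3-\frac{4\,\mathrm{ord}(\ell)}{h(-p)+\mathrm{ord}(\ell)}\right).$$
   Context: Let $p$ be a prime with $p\equiv 71$ or $119\pmod{120}$ and $\ell=2$. Let $h(-p)$ be the class number of $\mathbb{Q}(\sqrt{-p})$ (it is odd) and let $L=\mathrm{ord}(\ell)$ be the order in the class group of a prime ideal above $2$; $L$ is an odd integer $\ge3$ dividing $h(-p)$. The graph $\Gamma$ (denoted $\Gamma(\mathcal{G}_2(\mathbb{F}_p))$: the supersingular $2$-isogeny graph over $\mathbb{F}_p$ after identifying curves and isogenies up to $\overline{\mathbb{F}_p}$-equivalence, regarded as a simple undirected graph) is the disjoint union of one folded component $\mathcal{F}$ and $\frac12\left(\frac{h(-p)}{L}-1\right)$ stacked components, each a copy of $\mathcal{T}$, where $V(\mathcal{F})=\{0,\dots,L-1\}$, $E(\mathcal{F})=\{\{2k-1,2k+1\}: 1\le k\le \tfrac12(L-3)\}\cup\{\{2k+1,2k+2\}:0\le k\le \tfrac12(L-3)\}\cup\{\{0,1\}\}$, and $V(\mathcal{T})=\{0,\dots,2L-1\}$, $E(\mathcal{T})=\{\{2i,2i+1\}:0\le i\le L-1\}\cup\{\{2i+1,2i+3\}:0\le i\le L-2\}\cup\{\{2L-1,1\}\}$. For a graph with connected components $C_1,\dots,C_m$,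 $\mathrm{MeanDiam}$ is $\frac1m\sum_{i=1}^m\mathrm{diam}(C_i)$. *)

(* Defs.v *)
From HB Require Import structures.
From mathcomp Require Import all_boot all_order all_algebra all_field.

Set Implicit Arguments.
Unset Strict Implicit.
Unset Printing Implicit Defensive.

Import Order.TTheory GRing.Theory Num.Theory.

Local Open Scope ring_scope.

Section ImaginaryQuadratic.

Variable d : nat.

(* Q(sqrt(-d)) and its ring of integers, as subsets of the complex algebraic
   numbers. *)
Definition imagQuadField (x : algC) : Prop :=
  exists a b : rat, x = ratr a + ratr b * sqrtC (- d%:R).

Definition ringOfIntegers (x : algC) : Prop :=
  imagQuadField x /\ x \in Aint.

(* Ideals are subsets of algC, compared extensionally. *)
Definition is_ideal (I : algC -> Prop) : Prop :=
  [/\ forall x, I x -> ringOfIntegers x,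
      I 0,
      forall x y, I x -> I y -> I (x + y)
    & forall a x, ringOfIntegers a -> I x -> I (a * x)].

Definition is_nonzero_ideal (I : algC -> Prop) : Prop :=
  is_ideal I /\ exists2 x, I x & x <> 0.

Definition is_prime_ideal (P : algC -> Prop) : Prop :=
  [/\ is_ideal P,
      ~ P 1
    & forall x y, ringOfIntegers x -> ringOfIntegers y ->
        P (x * y) -> P x \/ P y].

Definition ideal_mul (I J : algC -> Prop) (z : algC) : Prop :=
  exists (n : nat) (x y : 'I_n -> algC),
    [/\ forall i, I (x i), forall i, J (y i) & z = \sum_(i < n) x i * y i].

Definition ideal_exp (I : algC -> Prop) (n : nat) : algC -> Prop :=
  iter n (ideal_mul I) ringOfIntegers.

(* I and J have the same ideal class: a I = b J for some nonzero integers
   a and b of the field. *)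
Definition same_class (I J : algC -> Prop) : Prop :=
  exists a b : algC,
    [/\ ringOfIntegers a, ringOfIntegers b, a <> 0, b <> 0
      & forall z, (exists2 x, I x & z = a * x) <->
                  (exists2 y, J y & z = b * y)].

(* The class number is h: every ideal class is represented exactly once in
   some family of h nonzero ideals. *)
Definition is_class_number (h : nat) : Prop :=
  exists R : 'I_h -> algC -> Prop,
    [/\ forall i, is_nonzero_ideal (R i),
        forall i j, same_class (R i) (R j) -> i = j
      & forall I, is_nonzero_ideal I -> exists i, same_class I (R i)].

(* L is the order of the class of P in the class group, whose neutral element
   is the class of the whole ring of integers. *)
Definition is_class_order (P : algC -> Prop) (L : nat) : Prop :=
  [/\ (0 < L)%N,
      same_class (ideal_exp P L) ringOfIntegers
    & forall m, (0 < m < L)%N -> ~ same_class (ideal_exp P m) ringOfIntegers].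

End ImaginaryQuadratic.

Record sgraph := SGraph {
  vertex :> finType;
  adj : rel vertex;
  adj_sym : symmetric adj;
  adj_irr : irreflexive adj }.

Section MeanDiameter.

Variable G : sgraph.

Definition components : {set {set G}} :=
  equivalence_partition (connect (@adj G)) [set: G].

(* The least number of edges of a walk from x to y; the value for x and y in
   different components is #|G|, and is not used below. *)
Definition dist (x y : G) : nat :=
  find (fun n => [exists w : n.-tuple G, path (@adj G) x w && (last x w == y)])
       (iota 0 #|G|).

(* For C a connected component this is the diameter of the graph induced on C,
   as walks do not leave C. *)
Definition diam (C : {set G}) : nat :=
  (\max_(x in C) \max_(y in C) dist x y)%N.

Definition meanDiam : rat :=
  (#|components|%:R)^-1 * \sum_(C in components) (diam C)%:R.

End MeanDiameter.

Section EdgeList.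

Variables (n : nat) (E : seq (nat * nat)).

Definition edge_adj : rel 'I_n := fun u v =>
  (u != v) && (((u : nat, v : nat) \in E) || ((v : nat, u : nat) \in E)).

Lemma edge_adj_sym : symmetric edge_adj.
Proof. by move=> u v; rewrite /edge_adj eq_sym orbC. Qed.

Lemma edge_adj_irr : irreflexive edge_adj.
Proof. by move=> u; rewrite /edge_adj eqxx. Qed.

Definition edge_graph : sgraph := SGraph edge_adj_sym edge_adj_irr.

End EdgeList.

Section DisjointUnion.

Variables G H : sgraph.

Definition union_adj : rel (G + H)%type := fun u v =>
  match u, v with
  | inl x, inl y => adj x y
  | inr x, inr y => adj x y
  | _, _ => false
  end.

Lemma union_adj_sym : symmetric union_adj.
Proof. by move=> [x|x] [y|y] //=; apply: adj_sym. Qed.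

Lemma union_adj_irr : irreflexive union_adj.
Proof. by move=> [x|x] /=; apply: adj_irr. Qed.

Definition disjoint_union : sgraph := SGraph union_adj_sym union_adj_irr.

End DisjointUnion.

Section Copies.

Variables (n : nat) (G : sgraph).

Definition copies_adj : rel ('I_n * G)%type := fun u v =>
  (u.1 == v.1) && adj u.2 v.2.

Lemma copies_adj_sym : symmetric copies_adj.
Proof. by move=> u v; rewrite /copies_adj eq_sym adj_sym. Qed.

Lemma copies_adj_irr : irreflexive copies_adj.
Proof. by move=> u; rewrite /copies_adj adj_irr andbF. Qed.

Definition copies : sgraph := SGraph copies_adj_sym copies_adj_irr.

End Copies.

Local Open Scope nat_scope.

(* In both edge lists L is meant to be odd and at least 3. *)
Definition folded_edges (L : nat) : seq (nat * nat) :=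
  [seq (2 * k - 1, 2 * k + 1) | k <- index_iota 1 ((L - 3) %/ 2).+1]
  ++ [seq (2 * k + 1, 2 * k + 2) | k <- index_iota 0 ((L - 3) %/ 2).+1]
  ++ [:: (0, 1)].

Definition stacked_edges (L : nat) : seq (nat * nat) :=
  [seq (2 * i, 2 * i + 1) | i <- index_iota 0 L]
  ++ [seq (2 * i + 1, 2 * i + 3) | i <- index_iota 0 (L - 1)]
  ++ [:: (2 * L - 1, 1)].

Definition folded (L : nat) : sgraph := edge_graph L (folded_edges L).

Definition stacked (L : nat) : sgraph := edge_graph (2 * L) (stacked_edges L).

(* The divisions are exact when h is an odd multiple of L. *)
Definition Gamma (h L : nat) : sgraph :=
  disjoint_union (folded L) (copies ((h %/ L - 1) %/ 2) (stacked L)).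

(* Main.v *)
Require Import Defs.
From mathcomp Require Import all_boot all_order all_algebra all_field.
From mathcomp Require Import boolp.
From mathcomp Require Import ring lra zify.

(** The diameters of the folded and stacked components are [(L + 1) / 2] and
    [(L + 3) / 2], so the formula reduces to three facts on the class group of
    [Q(sqrt(-p))]: [L] divides [h], [h] is odd, and [L] is not [1].
    The first two rest on [I * conj I = g O].  It gives cancellation, hence
    multiplication by the class of [P] permutes the classes with all orbits of
    length [L].  It also makes conjugation of classes an involution whose only
    fixed class is the trivial one: if [conj I = c I] then [c] has norm 1, so
    [c = e / conj e] (Hilbert 90) and [J = e I] is stable under conjugation; if
    [n] is the least positive integer in [J], then [J] lies between [n O] and
    [(n / sqrt(-p)) O], whose quotient has prime order, so [J] is one of them.
    Finally, a generator of [P] would have norm 2, which [p > 8] excludes, or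
    4, which would make 2 inert although [p = 7 mod 8]. *)

Set Implicit Arguments.
Unset Strict Implicit.
Unset Printing Implicit Defensive.

Import Order.TTheory GRing.Theory Num.Theory.

(** * Distances in disjoint unions *)

Local Open Scope nat_scope.

(** Lists replace the tuples of [dist], so that walks concatenate without casts on their lengths. *)
Definition walk (G : sgraph) (k : nat) (x y : G) : Prop :=
  exists s, [/\ size s = k, path (@adj G) x s & last x s = y].

Definition within (G : sgraph) (d : nat) (x y : G) : Prop :=
  exists2 k, k <= d & walk k x y.

Definition one_lipschitz (G : sgraph) (phi : G -> nat) : Prop :=
  forall u v, adj u v -> phi v <= (phi u).+1.

(* The lower bound is certified by a 1-Lipschitz function rather than by
   walks, because such functions extend by 0 to a disjoint union. *)
Definition has_diam (G : sgraph) (d : nat) : Prop :=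
  (forall x y : G, within d x y) /\
  exists (x y : G) (phi : G -> nat), one_lipschitz phi /\ phi x + d <= phi y.

Section Walks.

Variable G : sgraph.
Implicit Types x y z : G.

Lemma walk_refl x : walk 0 x x.
Proof. by exists [::]. Qed.

Lemma walk_trans j k x y z : walk j x y -> walk k y z -> walk (j + k) x z.
Proof.
move=> [s [<- sP <-]] [t [<- tP <-]]; exists (s ++ t).
by rewrite size_cat cat_path sP tP last_cat.
Qed.

Lemma walk_adj x y : adj x y -> walk 1 x y.
Proof. by move=> xy; exists [:: y]; rewrite /= xy. Qed.

Lemma walk_sym k x y : walk k x y -> walk k y x.
Proof.
move=> [s [<- sP <-]]; elim/last_ind: s sP => [|s z IHs]; first by exists [::].
rewrite rcons_path size_rcons last_rcons => /andP[/IHs sP sz].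
by apply: (walk_trans (j := 1)) sP; apply: walk_adj; rewrite adj_sym.
Qed.

Lemma walk_lipschitz (phi : G -> nat) k x y :
  one_lipschitz phi -> walk k x y -> phi y <= phi x + k.
Proof.
move=> phi_lip [s [<- sP <-]]; elim: s x sP => [|z s IHs] x /=; first by rewrite addn0.
by move=> /andP[/phi_lip xz /IHs zs]; lia.
Qed.

Lemma within_trans a b x y z : within a x y -> within b y z -> within (a + b) x z.
Proof.
move=> [j ja xy] [k kb yz]; exists (j + k); first exact: leq_add.
exact: walk_trans xy yz.
Qed.

Lemma within_sym d x y : within d x y -> within d y x.
Proof. by move=> [k kd /walk_sym]; exists k. Qed.

Lemma within_connect d x y : within d x y -> connect (@adj G) x y.
Proof. by move=> [k _ [s [_ sP sE]]]; apply/connectP; exists s. Qed.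

(** The search in [dist] stops below [#|G|], hence the bound on [d]. *)
Lemma dist_le d x y : d < #|G| -> within d x y -> dist x y <= d.
Proof.
move=> dG [k kd [s [sk sP sE]]]; apply: leq_trans (kd).
rewrite /dist leqNgt; apply/negP => /(before_find 0).
rewrite nth_iota; last exact: leq_ltn_trans dG.
move=> /negbT/negP; apply; apply/existsP; have sk' : size s == k by apply/eqP.
by exists (Tuple sk'); rewrite /= sP sE eqxx.
Qed.

(** The default value [#|G|] of [dist] is at least [d], so only a successful search matters, and it
    yields a walk of length [dist x y]. *)
Lemma le_dist d x y :
  d <= #|G| -> (forall k, walk k x y -> d <= k) -> d <= dist x y.
Proof.
move=> dG walk_ge; rewrite leqNgt; apply/negP => lt_d.
have lt_G : dist x y < #|G| by apply: leq_trans dG.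
have := lt_G; rewrite -[X in _ < X](size_iota 0) -has_find => /(nth_find 0).
rewrite -/(dist x y) nth_iota // => /existsP[w /andP[wP /eqP wE]].
suff /walk_ge : walk (dist x y) x y by lia.
by exists w; rewrite size_tuple.
Qed.

End Walks.

Lemma walk_map (G H : sgraph) (f : G -> H) k x y :
  (forall u v, adj u v -> adj (f u) (f v)) -> walk k x y -> walk k (f x) (f y).
Proof.
move=> f_adj [s [<- sP <-]]; exists (map f s).
rewrite size_map last_map; split=> //; rewrite path_map.
exact: sub_path sP.
Qed.

(** Edges preserve labels and any two vertices with equal labels are joined by a walk, so the
    connected components are exactly the fibres of [lab]. In each fibre the walks bound the diameter
    from above and the Lipschitz function bounds it from below. *)
Lemma meanDiam_label (G : sgraph) (I : finType) (lab : G -> I) (d : I -> nat) :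
  (forall u v : G, adj u v -> lab u = lab v) ->
  (forall i, d i < #|G|) ->
  (forall u v : G, lab u = lab v -> within (d (lab u)) u v) ->
  (forall i, exists x y : G, [/\ lab x = i, lab y = i
     & exists phi, one_lipschitz phi /\ phi x + d i <= phi y]) ->
  meanDiam G = ((#|I|%:R)^-1 * \sum_i (d i)%:R)%R.
Proof.
move=> lab_adj dG lab_within lab_far.
have connectE x y : connect (@adj G) x y = (lab x == lab y).
  apply/idP/eqP => [/connectP[s sP ->]|/lab_within/within_connect //].
  by elim: s x sP => //= z s IHs x /andP[/lab_adj -> /IHs].
pose C i := [set x | lab x == i].
have C_inj : injective C.
  move=> i j Cij; have [x [_ [xi _ _]]] := lab_far i.
  have : x \in C i by rewrite inE xi.
  by rewrite Cij inE xi => /eqP.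
have componentsE : components G = [set C i | i in I].
  apply/setP => A; apply/imsetP/imsetP => [[x _ ->]|[i _ ->]].
    exists (lab x) => //; apply/setP => y.
    by rewrite !inE connectE eq_sym.
  have [x [_ [xi _ _]]] := lab_far i; exists x; rewrite ?inE //.
  by apply/setP => y; rewrite !inE connectE xi eq_sym.
rewrite /meanDiam componentsE card_imset //; congr (_ * _)%R.
rewrite big_imset /=; last by move=> i j _ _; apply: C_inj.
apply: eq_bigr => i _; congr (_%:R)%R; apply/eqP; rewrite eqn_leq; apply/andP; split.
  apply/bigmax_leqP => x; rewrite inE => /eqP xi; apply/bigmax_leqP => y.
  rewrite inE => /eqP yi; apply: dist_le => //; rewrite -xi; apply: lab_within.
  by rewrite xi yi.
have [x [y [xi yi [phi [phi_lip phi_xy]]]]] := lab_far i.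
have xC : x \in C i by rewrite inE xi.
have yC : y \in C i by rewrite inE yi.
apply: leq_trans (leq_bigmax_cond _ xC); apply: leq_trans (leq_bigmax_cond _ yC).
apply: le_dist; first by rewrite ltnW.
by move=> k /(walk_lipschitz phi_lip); lia.
Qed.

(** The label [None] marks [G] and [Some i] marks the [i]-th copy of [H]; a Lipschitz function on
    one component is extended by 0 to the others. *)
Lemma meanDiam_union_copies (G H : sgraph) (n a b : nat) :
  has_diam G a -> has_diam H b -> a < #|G| -> b < #|G| + #|H| ->
  meanDiam (disjoint_union G (copies n H)) = ((n.+1)%:R^-1 * (a%:R + n%:R * b%:R))%R.
Proof.
move=> [Gw [x [y [phi [phi_lip phi_xy]]]]] [Hw [x' [y' [psi [psi_lip psi_xy]]]]] aG bGH.
pose lab (u : disjoint_union G (copies n H)) : option 'I_n :=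
  if u is inr v then Some v.1 else None.
pose d (i : option 'I_n) := if i is Some _ then b else a.
have -> : n.+1 = #|{: option 'I_n}| by rewrite card_option card_ord.
rewrite (@meanDiam_label _ _ lab d).
- congr (_ * _)%R; rewrite (bigD1 None) //=; congr (_ + _)%R.
  rewrite (eq_bigr (fun=> b%:R%R)); last by case.
  rewrite sumr_const [RHS]mulr_natl; congr (_ *+ _)%R.
  by have := cardC1 (None : option 'I_n); rewrite card_option card_ord.
- by case=> [u|[i u]] [v|[j v]] //= /andP[/eqP /= ->].
- move=> i; rewrite card_sum card_prod card_ord; case: i => [i|] /=.
    (* The index [i] itself shows that there is at least one copy of [H]. *)
    by apply: leq_trans bGH _; rewrite leq_add2l leq_pmull //; case: (n) i => // -[].
  exact: leq_trans aG (leq_addr _ _).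
- case=> [u|[i u]] [v|[j v]] //=.
    by move=> _; have [k ka kw] := Gw u v; exists k => //; apply: walk_map kw.
  move=> [<-]; have [k ka kw] := Hw u v; exists k => //.
  apply: (@walk_map H (disjoint_union G (copies n H)) (fun w => inr (i, w))) kw.
  by move=> w w' ww'; rewrite /= /copies_adj eqxx.
- case=> [i|].
    exists (inr (i, x')), (inr (i, y')); split=> //.
    exists (fun u => if u is inr v then psi v.2 else 0); split=> //.
    by case=> [u|[j u]] [v|[k v]] //= /andP[_ /psi_lip].
  exists (inl x), (inl y); split=> //.
  exists (fun u => if u is inl v then phi v else 0); split=> //.
  by case=> [u|[j u]] [v|[k v]] //= /phi_lip.
Qed.

(** * Diameters of the folded and stacked components *)

(** The graph is a caterpillar: the odd vertices form a path with [m - 1] edges, and each even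
    vertex is a leaf attached to it. Two legs of length at most 1 and the path give the upper bound,
    attained between 0 and [2 * m]. *)
Lemma folded_diam (m : nat) : 0 < m -> has_diam (folded (2 * m + 1)) m.+1.
Proof.
move=> m0; set L := 2 * m + 1; have LE : L = 2 * m + 1 by [].
have adjI (u v : folded L) : u <> v :> nat ->
    (u : nat, v : nat) \in folded_edges L -> adj u v.
  by move=> uv uvE; rewrite /= /edge_adj uvE andbT; apply/eqP => uv'; rewrite uv' in uv.
have spine e i (x y : folded L) :
    x = 2 * i + 1 :> nat -> y = 2 * (i + e) + 1 :> nat -> walk e x y.
  elim: e y => [|e IHe] y xi yi.
    have -> : y = x by apply: val_inj; rewrite /= xi yi addn0.
    exact: walk_refl.
  have := ltn_ord y => y_lt.
  have z_lt : 2 * (i + e) + 1 < L by lia.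
  rewrite -addn1; apply: (walk_trans (y := Ordinal z_lt : folded L)).
    exact: IHe.
  apply: walk_adj; apply: adjI; rewrite yi /=; first by lia.
  rewrite !mem_cat; apply/or3P; constructor 1; apply/mapP; exists (i + e).+1.
    by rewrite mem_index_iota; lia.
  congr (_, _); lia.
have leg (x : folded L) : exists2 i, i < m &
    exists2 c : folded L, c = 2 * i + 1 :> nat & within 1 x c.
  have x_lt := ltn_ord x.
  have [x0|x0] := eqVneq (x : nat) 0.
    have c_lt : 1 < L by lia.
    exists 0 => //; exists (Ordinal c_lt) => //; exists 1 => //.
    apply: walk_adj; apply: adjI; rewrite x0 //=.
    by rewrite !mem_cat; apply/or3P; constructor 3; rewrite inE.
  (* The vertices [2 * i + 1] and [2 * i + 2] both belong to position [i] of the path. *)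
  have [i iE] : exists i, i = (x.-1 %/ 2) by exists (x.-1 %/ 2).
  exists i; first by lia.
  have c_lt : 2 * i + 1 < L by lia.
  exists (Ordinal c_lt) => //.
  have [x1|x1] := eqVneq (x : nat) (2 * i + 1).
    exists 0 => //; have -> : x = Ordinal c_lt by apply: val_inj.
    exact: walk_refl.
  exists 1 => //; apply: walk_sym; apply: walk_adj; apply: adjI => /=; first by lia.
  rewrite !mem_cat; apply/or3P; constructor 2; apply/mapP; exists i.
    by rewrite mem_index_iota; lia.
  congr (_, _); lia.
split=> [x y|].
  have [i im [c cE xc]] := leg x; have [j jm [c' cE' yc]] := leg y.
  have -> : m.+1 = 1 + (m.-1 + 1) by lia.
  apply: within_trans xc _; apply: within_trans (within_sym yc).
  have [ij|ji] := leqP i j.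
    by exists (j - i); [lia | apply: (spine _ i) => //; rewrite subnKC].
  exists (i - j); first by lia.
  by apply: walk_sym; apply: (spine _ j) => //; rewrite subnKC // ltnW.
have lt0 : 0 < L by lia.
have ltm : 2 * m < L by lia.
(* This is the distance from the leaf 0. *)
pose phi (v : nat) := if v == 0 then 0 else (v %/ 2).+1.
exists (Ordinal lt0), (Ordinal ltm), (fun v : 'I_L => phi v); split; last first.
  by rewrite /phi /=; case: ifP => /eqP; lia.
suff phiP a b : (a, b) \in folded_edges L -> phi a <= (phi b).+1 /\ phi b <= (phi a).+1.
  by move=> u v /andP[_ /orP[/phiP[]|/phiP[]]].
rewrite !mem_cat => /or3P[/mapP[k kI [-> ->]]|/mapP[k kI [-> ->]]|].
- rewrite mem_index_iota in kI; rewrite /phi.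
  by do 2 case: ifP => /eqP ?; lia.
- by rewrite /phi; do 2 case: ifP => /eqP ?; lia.
- by rewrite inE => /eqP[-> ->].
Qed.

(** The odd vertices form a cycle of length [2 * m + 1], of diameter [m], and each carries one even
    leaf; two legs add 2. The bound is attained between 0 and [2 * m], whose feet 1 and [2 * m + 1]
    are [m] steps apart on the cycle. *)
Lemma stacked_diam (m : nat) : 0 < m -> has_diam (stacked (2 * m + 1)) m.+2.
Proof.
move=> m0; set L := 2 * m + 1; have LE : L = 2 * m + 1 by [].
have adjI (u v : stacked L) : u <> v :> nat ->
    (u : nat, v : nat) \in stacked_edges L -> adj u v.
  by move=> uv uvE; rewrite /= /edge_adj uvE andbT; apply/eqP => uv'; rewrite uv' in uv.
have spine e i (x y : stacked L) :
    x = 2 * i + 1 :> nat -> y = 2 * (i + e) + 1 :> nat -> walk e x y.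
  elim: e y => [|e IHe] y xi yi.
    have -> : y = x by apply: val_inj; rewrite /= xi yi addn0.
    exact: walk_refl.
  have := ltn_ord y => y_lt.
  have z_lt : 2 * (i + e) + 1 < 2 * L by lia.
  rewrite -addn1; apply: (walk_trans (y := Ordinal z_lt : stacked L)).
    exact: IHe.
  apply: walk_adj; apply: adjI; rewrite yi /=; first by lia.
  rewrite !mem_cat; apply/or3P; constructor 2; apply/mapP; exists (i + e).
    by rewrite mem_index_iota; lia.
  congr (_, _); lia.
have cycle i j (x y : stacked L) : i <= j ->
    x = 2 * i + 1 :> nat -> y = 2 * j + 1 :> nat -> within m x y.
  move=> ij xi yj; have := ltn_ord y => y_lt.
  have [close|far] := leqP (j - i) m.
    by exists (j - i) => //; apply: (spine _ i) => //; rewrite subnKC.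
  (* When the direct arc is longer than [m], the walk goes down to 1, across the closing edge to
     [2 * L - 1], and down to [y]; its length is [L - (j - i)]. *)
  have first_lt : 1 < 2 * L by lia.
  have last_lt : 2 * L - 1 < 2 * L by lia.
  exists (i + (1 + (L - 1 - j))); first by lia.
  apply: (walk_trans (y := Ordinal first_lt : stacked L)).
    by apply: walk_sym; apply: (spine _ 0); rewrite /= ?xi.
  apply: (walk_trans (y := Ordinal last_lt : stacked L)).
    apply: walk_sym; apply: walk_adj; apply: adjI => /=; first by lia.
    by rewrite !mem_cat; apply/or3P; constructor 3; rewrite inE.
  by apply: walk_sym; apply: (spine _ j) => //=; lia.
have leg (x : stacked L) : exists i,
    exists2 c : stacked L, c = 2 * i + 1 :> nat & within 1 x c.
  have x_lt := ltn_ord x.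
  have [i iE] : exists i, i = (x %/ 2) by exists (x %/ 2).
  exists i; have c_lt : 2 * i + 1 < 2 * L by lia.
  exists (Ordinal c_lt) => //.
  have [x1|x1] := eqVneq (x : nat) (2 * i + 1).
    exists 0 => //; have -> : x = Ordinal c_lt by apply: val_inj.
    exact: walk_refl.
  exists 1 => //; apply: walk_adj; apply: adjI => /=; first by lia.
  rewrite !mem_cat; apply/or3P; constructor 1; apply/mapP; exists i.
    by rewrite mem_index_iota; lia.
  congr (_, _); lia.
split=> [x y|].
  have [i [c cE xc]] := leg x; have [j [c' cE' yc]] := leg y.
  have -> : m.+2 = 1 + (m + 1) by lia.
  apply: within_trans xc _; apply: within_trans (within_sym yc).
  have [ij|/ltnW ji] := leqP i j; first exact: (cycle i j).
  by apply: within_sym; apply: (cycle j i).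
have lt0 : 0 < 2 * L by lia.
have ltm : 2 * m < 2 * L by lia.
(* This is the distance from the leaf 0: the shorter arc between the feet, plus the leg at 0, plus a
   second leg when [v] is even. *)
pose phi (v : nat) := if v == 0 then 0 else minn (v %/ 2) (L - v %/ 2) + (2 - v %% 2).
exists (Ordinal lt0), (Ordinal ltm), (fun v : 'I_(2 * L) => phi v); split; last first.
  by rewrite /phi /=; case: ifP => /eqP; lia.
suff phiP a b : (a, b) \in stacked_edges L -> phi a <= (phi b).+1 /\ phi b <= (phi a).+1.
  by move=> u v /andP[_ /orP[/phiP[]|/phiP[]]].
rewrite !mem_cat => /or3P[/mapP[k kI [-> ->]]|/mapP[k kI [-> ->]]|].
- rewrite mem_index_iota in kI; rewrite /phi.
  by do 2 case: ifP => /eqP ?; lia.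
- rewrite mem_index_iota in kI; rewrite /phi.
  by do 2 case: ifP => /eqP ?; lia.
- by rewrite inE => /eqP[-> ->]; rewrite /phi /=; case: ifP => /eqP ?; lia.
Qed.

(** With [L = 2 * m + 1] and [h = (2 * n + 1) * L] there are [n] stacked components, and both sides
    equal [m + 2 - 1 / (n + 1)]. *)
Lemma meanDiam_Gamma (h L : nat) :
  odd h -> L %| h -> 2 < L ->
  meanDiam (Gamma h L) =
    (2%:R^-1 * (L%:R + 3%:R - 4%:R * L%:R / (h%:R + L%:R)))%R.
Proof.
move=> h_odd /dvdnP[q hE] L_gt2.
have [m Lm] : exists m, L = 2 * m + 1.
  by exists L./2; have := odd_double_half L; move: h_odd; rewrite hE oddM => /andP[_ ->]; lia.
have [n qn] : exists n, q = 2 * n + 1.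
  by exists q./2; have := odd_double_half q; move: h_odd; rewrite hE oddM => /andP[-> _]; lia.
have m0 : 0 < m by lia.
have -> : Gamma h L = disjoint_union (folded (2 * m + 1)) (copies n (stacked (2 * m + 1))).
  rewrite /Gamma hE mulnK; last by lia.
  have -> : (q - 1) %/ 2 = n by lia.
  by rewrite Lm.
rewrite (meanDiam_union_copies n (folded_diam m0) (stacked_diam m0)).
- rewrite hE Lm qn.
  have oddE k : ((2 * k + 1)%:R = 2%:R * k%:R + 1 :> rat)%R by rewrite natrD natrM.
  rewrite natrM !oddE -[m.+2%:R%R]natr1 -[m.+1%:R%R]natr1 -[n.+1%:R%R]natr1.
  have n0 : (0 <= n%:R :> rat)%R by rewrite ler0n.
  have mQ : (0 <= m%:R :> rat)%R by rewrite ler0n.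
  move: n0 mQ; move: (n%:R)%R (m%:R)%R => x y; clear => x0 y0.
  (* The denominators are nonzero because [x] and [y] are nonnegative. *)
  field; nra.
- rewrite card_ord; lia.
- rewrite !card_ord; lia.
Qed.

Local Open Scope ring_scope.

(** * Integers of the quadratic field *)

Lemma Aint_quadratic_root (t n x : algC) :
  t \in Num.int -> n \in Num.int -> x ^+ 2 - t * x + n = 0 -> x \in Aint.
Proof.
move=> /intrP[t' ->] /intrP[n' ->] x0.
pose q : {poly algC} := Poly [:: n'%:~R; - t'%:~R; 1].
have qE : q = [:: n'%:~R; - t'%:~R; 1] :> seq algC.
  by rewrite /q (@PolyK _ 0) //= oner_neq0.
apply: (@root_monic_Aint q).
- by rewrite /root -[_.[x]]/(horner_rec q x) qE /=; apply/eqP; rewrite -[RHS]x0; ring.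
- by rewrite monicE lead_coefE qE.
- apply/polyOverP => i; rewrite qE.
  by case: i => [|[|[|i]]] /=; rewrite ?nth_nil ?rpredN ?rpred0 ?rpred1 ?intr_int.
Qed.

(** The number [p * r] is rational and its square is [p * m], an integer, so it is itself an integer
    [k]. As [p] divides [k ^ 2], it divides [k]. *)
Lemma Cint_prime_mul_sqr (p : nat) (r : algC) :
  prime p -> r \in Crat -> p%:R * r ^+ 2 \in Num.int -> r \in Num.int.
Proof.
move=> p_pr rQ /intrP[m mE].
have p0 : p%:R != 0 :> algC by rewrite pnatr_eq0 -lt0n prime_gt0.
have /intrP[k kE] : p%:R * r \in Num.int.
  apply: Cint_rat_Aint; first by rewrite rpredM // rpred_nat.
  apply: (@Aint_quadratic_root 0 (- (p%:Z * m)%:~R)); rewrite ?rpred0 ?rpredN ?intr_int //.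
  rewrite intrM -mE /=; ring.
have kk : k ^+ 2 = p%:Z * m.
  apply: (@intr_inj algC); rewrite rmorphXn /= -kE intrM -mE -pmulrn; ring.
have /dvdzP[q qE] : (p%:Z %| k)%Z.
  have : (p%:Z %| k ^+ 2)%Z by rewrite kk dvdz_mulr.
  by rewrite !dvdzE abszX Euclid_dvdX // andbT.
have -> : r = q%:~R.
  apply: (mulfI p0); rewrite kE qE intrM mulrC //.
exact: intr_int.
Qed.

Section QuadraticField.

Variable p : nat.
Hypothesis p_prime : prime p.
Hypothesis p_mod4 : (p %% 4 = 3)%N.

Local Notation K := (imagQuadField p).
Local Notation O := (ringOfIntegers p).
Local Notation s := (sqrtC (- p%:R) : algC).

Lemma sqrtN_sqr : s * s = - p%:R.
Proof. by rewrite -expr2 sqrtCK. Qed.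

Lemma natr_prime_neq0 : p%:R != 0 :> algC.
Proof. by rewrite pnatr_eq0 -lt0n prime_gt0. Qed.

Lemma sqrtN_neq0 : s != 0.
Proof. by rewrite sqrtC_eq0 oppr_eq0 natr_prime_neq0. Qed.

(** Both [s] and its conjugate square to [-p], so they agree up to sign; a real [s] would have a
    nonnegative square. *)
Lemma conj_sqrtN : s^* = - s.
Proof.
have : (s^* - s) * (s^* + s) = 0.
  have -> : (s^* - s) * (s^* + s) = s^* * s^* - s * s by ring.
  by rewrite -rmorphM sqrtN_sqr rmorphN /= rmorph_nat subrr.
move=> /eqP; rewrite mulf_eq0 subr_eq0 addr_eq0 => /orP[/eqP /CrealP sR|/eqP//].
have := real_exprn_even_ge0 (n := 2) sR isT.
rewrite expr2 sqrtN_sqr oppr_ge0 lern0 => /eqP p0.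
by move: p_prime; rewrite p0.
Qed.

(** Coordinates in [Crat] let the [rpred] lemmas prove the closure properties of the field. *)
Lemma fieldP (x : algC) :
  K x <-> exists a b, [/\ a \in Crat, b \in Crat & x = a + b * s].
Proof.
split=> [[a [b ->]]|[a [b [/CratP[a' ->] /CratP[b' ->] ->]]]].
  by exists (ratr a), (ratr b); split=> //; apply/CratP; eexists.
by exists a', b'.
Qed.

Lemma field_Crat (x : algC) : x \in Crat -> K x.
Proof. by move=> xQ; apply/fieldP; exists x, 0; rewrite rpred0 mul0r addr0. Qed.

Lemma field_sqrtN : K s.
Proof. by apply/fieldP; exists 0, 1; rewrite rpred0 rpred1 mul1r add0r. Qed.

Lemma fieldD (x y : algC) : K x -> K y -> K (x + y).
Proof.
move=> /fieldP[a [b [aQ bQ ->]]] /fieldP[c [d [cQ dQ ->]]]; apply/fieldP.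
by exists (a + c), (b + d); split; rewrite ?rpredD //; ring.
Qed.

Lemma fieldM (x y : algC) : K x -> K y -> K (x * y).
Proof.
move=> /fieldP[a [b [aQ bQ ->]]] /fieldP[c [d [cQ dQ ->]]]; apply/fieldP.
exists (a * c - p%:R * (b * d)), (a * d + b * c).
split; rewrite ?rpredD ?rpredN ?rpredM ?rpred_nat //.
move: sqrtN_sqr; move: (s) => t tE.
have -> : p%:R = - (t * t) by rewrite tE opprK.
ring.
Qed.

Lemma fieldN (x : algC) : K x -> K (- x).
Proof. by rewrite -mulN1r; apply/fieldM/field_Crat; rewrite rpredN rpred1. Qed.

Lemma conj_field (a b : algC) :
  a \in Crat -> b \in Crat -> (a + b * s)^* = a - b * s.
Proof.
by move=> aQ bQ; rewrite rmorphD rmorphM /= conj_sqrtN !conj_Crat // mulrN.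
Qed.

Lemma field_conj (x : algC) : K x -> K x^*.
Proof.
move=> /fieldP[a [b [aQ bQ ->]]]; rewrite conj_field //; apply/fieldP.
by exists a, (- b); rewrite rpredN mulNr.
Qed.

Lemma Crat_norm (x : algC) : K x -> x * x^* \in Crat.
Proof.
move=> /fieldP[a [b [aQ bQ ->]]]; rewrite conj_field //.
have -> : (a + b * s) * (a - b * s) = a * a - b * b * (s * s) by ring.
by rewrite sqrtN_sqr rpredB ?rpredM ?rpredN ?rpred_nat.
Qed.

Lemma Crat_trace (x : algC) : K x -> x + x^* \in Crat.
Proof.
move=> /fieldP[a [b [aQ bQ ->]]]; rewrite conj_field //.
have -> : (a + b * s) + (a - b * s) = a + a by ring.
by rewrite rpredD.
Qed.

Lemma norm_eq0 (x : algC) : (x * x^* == 0) = (x == 0).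
Proof. by rewrite mulf_eq0 fmorph_eq0 orbb. Qed.

Lemma fieldV (x : algC) : K x -> K x^-1.
Proof.
move=> xK; have [->|x0] := eqVneq x 0; first by rewrite invr0; apply: field_Crat; rewrite rpred0.
have -> : x^-1 = (x * x^*)^-1 * x^*.
  by rewrite invfM mulfVK // fmorph_eq0.
by apply: fieldM; [apply: field_Crat; rewrite rpredV Crat_norm | apply: field_conj].
Qed.

Lemma integer_int (x : algC) : x \in Num.int -> O x.
Proof.
move=> xZ; split; last exact: Aint_Cint.
by case/intrP: xZ => m ->; apply: field_Crat; rewrite rpred_int.
Qed.

Lemma integer0 : O 0. Proof. by apply: integer_int; rewrite rpred0. Qed.
Lemma integer1 : O 1. Proof. by apply: integer_int; rewrite rpred1. Qed.

Lemma integerD (x y : algC) : O x -> O y -> O (x + y).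
Proof. by move=> [xK xA] [yK yA]; split; [apply: fieldD | apply: rpredD]. Qed.

Lemma integerM (x y : algC) : O x -> O y -> O (x * y).
Proof. by move=> [xK xA] [yK yA]; split; [apply: fieldM | apply: rpredM]. Qed.

Lemma integerN (x : algC) : O x -> O (- x).
Proof. by move=> [xK xA]; split; [apply: fieldN | rewrite rpredN]. Qed.

Lemma integer_conj (x : algC) : O x -> O x^*.
Proof. by move=> [xK xA]; split; [apply: field_conj | rewrite (Aint_aut Num.conj)]. Qed.

Lemma int_trace (x : algC) : O x -> x + x^* \in Num.int.
Proof.
move=> xO; have [xK' xA'] := integer_conj xO; case: xO => xK xA.
by apply: Cint_rat_Aint; [apply: Crat_trace | apply: rpredD].
Qed.

Lemma int_norm (x : algC) : O x -> x * x^* \in Num.int.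
Proof.
move=> xO; have [xK' xA'] := integer_conj xO; case: xO => xK xA.
by apply: Cint_rat_Aint; [apply: Crat_norm | apply: rpredM].
Qed.

(** This is the integrality test used throughout: [x] is a root of [X^2 - t X + n] with [t] its
    trace and [n] its norm. *)
Lemma integer_trace_norm (x : algC) :
  K x -> x + x^* \in Num.int -> x * x^* \in Num.int -> O x.
Proof.
move=> xK tZ nZ; split=> //; apply: (Aint_quadratic_root tZ nZ); ring.
Qed.

Lemma integer_sqrtN : O s.
Proof.
apply: integer_trace_norm; first exact: field_sqrtN.
  by rewrite conj_sqrtN subrr rpred0.
by rewrite conj_sqrtN mulrN sqrtN_sqr opprK rpred_nat.
Qed.

Local Notation omega := ((1 + s) / 2%:R).

Lemma conj_omega : omega^* = (1 - s) / 2%:R.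
Proof. by rewrite rmorphM rmorphD /= conj_sqrtN rmorph1 fmorphV rmorph_nat. Qed.

Lemma trace_omega : omega + omega^* = 1.
Proof. by rewrite conj_omega; field; rewrite ?pnatr_eq0. Qed.

Lemma norm_omega : omega * omega^* = (p.+1 %/ 4)%N%:R.
Proof.
have pE : p.+1 = (4 * (p.+1 %/ 4))%N by lia.
have : p.+1%:R = (4 * (p.+1 %/ 4))%N%:R :> algC by rewrite -pE.
rewrite natrM -natr1 conj_omega => pE'.
have -> : (1 + s) / 2%:R * ((1 - s) / 2%:R) = (1 - s * s) / 4%:R by field; rewrite ?pnatr_eq0.
by rewrite sqrtN_sqr opprK addrC pE' mulrAC mulfV ?mul1r // pnatr_eq0.
Qed.

Lemma integer_omega : O omega.
Proof.
apply: integer_trace_norm; last by rewrite norm_omega rpred_nat.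
  apply: fieldM; last by apply: field_Crat; rewrite rpredV rpred_nat.
  by apply: fieldD field_sqrtN; apply: field_Crat; rewrite rpred1.
by rewrite trace_omega rpred1.
Qed.

(** For [x = a + b * s] the number [v = 2 b] is rational and [p * v ^ 2] equals four times the norm
    minus the squared trace, an integer; a prime [p] cannot cancel a denominator of [v ^ 2]. *)
Lemma integer_im (x : algC) :
  O x -> exists2 v, v \in Num.int & x - x^* = v * s.
Proof.
move=> xO; have tZ := int_trace xO; have nZ := int_norm xO.
case: (xO) => /fieldP[a [b [aQ bQ xE]]] _.
have xE' : x^* = a - b * s by rewrite xE conj_field.
exists (b + b); last by rewrite xE' xE; ring.
apply: (Cint_prime_mul_sqr p_prime); first by rewrite rpredD.
have -> : p%:R * (b + b) ^+ 2 = 4%:R * (x * x^*) - (x + x^*) ^+ 2.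
  rewrite xE' xE; move: sqrtN_sqr; move: (s) => t tE.
  have -> : p%:R = - (t * t) by rewrite tE opprK.
  ring.
by apply: rpredB; [apply: rpredM; rewrite ?rpred_nat | apply: rpredX].
Qed.

Lemma field_clear_denom (x : algC) : K x -> exists2 n : nat, (0 < n)%N & O (n%:R * x).
Proof.
move=> [a [b ->]].
have denE (c : rat) : (`|denq c|%N)%:R * (ratr c : algC) \in Num.int.
  rewrite -[c in ratr c]divq_num_den rmorphM fmorphV /= !ratr_int.
  rewrite pmulrn absz_denq mulrC mulfVK ?intr_int // intr_eq0 denq_neq0 //.
exists (`|denq a| * `|denq b|)%N; first by rewrite muln_gt0 !absz_gt0 !denq_neq0.
have -> : (`|denq a| * `|denq b|)%N%:R * (ratr a + ratr b * s) =
   `|denq b|%N%:R * (`|denq a|%N%:R * ratr a)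
   + `|denq a|%N%:R * (`|denq b|%N%:R * ratr b) * s by rewrite natrM; ring.
apply: integerD; first by apply: integer_int; rewrite rpredM ?rpred_nat.
by apply: integerM integer_sqrtN; apply: integer_int; rewrite rpredM ?rpred_nat.
Qed.

End QuadraticField.

(** * Ideals and their classes *)

Definition scale_set (c : algC) (I : algC -> Prop) : algC -> Prop :=
  fun z => exists2 x, I x & z = c * x.

(** A preimage, which is also the image because conjugation is an involution. *)
Definition conj_set (I : algC -> Prop) : algC -> Prop := fun z => I z^*.

(** Extensionality turns equivalence of ideals into an equality that can be rewritten. *)
Lemma set_ext (I J : algC -> Prop) : (forall z, I z <-> J z) -> I = J.
Proof. by move=> IJ; apply/predeqP. Qed.

Lemma scale_set1 (I : algC -> Prop) : scale_set 1 I = I.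
Proof.
apply: set_ext => z; split=> [[x Ix ->]|Iz]; first by rewrite mul1r.
by exists z; rewrite ?mul1r.
Qed.

Lemma scale_setM (c d : algC) (I : algC -> Prop) :
  scale_set c (scale_set d I) = scale_set (c * d) I.
Proof.
apply: set_ext => z; split=> [[x [y Iy ->] ->]|[y Iy ->]].
  by exists y; rewrite ?mulrA.
by exists (d * y); [exists y | rewrite mulrA].
Qed.

Lemma scale_setP (c : algC) (I : algC -> Prop) (z : algC) :
  c != 0 -> scale_set c I z <-> I (c^-1 * z).
Proof.
move=> c0; split=> [[x Ix ->]|Ix]; first by rewrite mulKf.
by exists (c^-1 * z); rewrite ?mulVKf.
Qed.

Lemma scale_set_inj (c : algC) (I J : algC -> Prop) :
  c != 0 -> scale_set c I = scale_set c J -> I = J.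
Proof.
move=> c0 IJ; rewrite -(scale_set1 I) -(scale_set1 J) -(mulVf c0).
by rewrite -!scale_setM IJ.
Qed.

Lemma conj_setK (I : algC -> Prop) : conj_set (conj_set I) = I.
Proof. by apply: set_ext => z; rewrite /conj_set /= conjCK. Qed.

Lemma conj_set_scale (c : algC) (I : algC -> Prop) :
  conj_set (scale_set c I) = scale_set c^* (conj_set I).
Proof.
apply: set_ext => z; split=> [[x Ix zE]|[x Ix ->]].
  by exists x^*; [rewrite /conj_set conjCK | rewrite -rmorphM -zE /= conjCK].
by exists x^*; rewrite // rmorphM /= conjCK.
Qed.

Lemma ideal_mul_in (I J : algC -> Prop) x y :
  I x -> J y -> ideal_mul I J (x * y).
Proof.
by move=> Ix Jy; exists 1%N, (fun=> x), (fun=> y); split=> //; rewrite big_ord1.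
Qed.

Lemma ideal_mul0 (I J : algC -> Prop) : ideal_mul I J 0.
Proof.
exists 0%N, (fun=> 0), (fun=> 0); split; rewrite ?big_ord0 //.
- by case.
- by case.
Qed.

Lemma ideal_mulD (I J : algC -> Prop) x y :
  ideal_mul I J x -> ideal_mul I J y -> ideal_mul I J (x + y).
Proof.
move=> [m [u [v [Iu Jv ->]]]] [n [u' [v' [Iu' Jv' ->]]]].
exists (m + n)%N, (fun i => match split i with inl j => u j | inr j => u' j end),
  (fun i => match split i with inl j => v j | inr j => v' j end).
split=> [i|i|]; try by case: (split i).
rewrite big_split_ord /=; congr (_ + _); apply: eq_bigr => i _.
  by rewrite (unsplitK (inl i)).
by rewrite (unsplitK (inr i)).
Qed.

Lemma ideal_mul_ind (I J A : algC -> Prop) :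
  A 0 -> (forall x y, A x -> A y -> A (x + y)) ->
  (forall x y, I x -> J y -> A (x * y)) ->
  forall z, ideal_mul I J z -> A z.
Proof.
move=> A0 AD AM z [n [x [y [Ix Jy ->]]]].
by elim/big_ind: _ => // i _; apply: AM.
Qed.

Lemma ideal_mulC (I J : algC -> Prop) : ideal_mul I J = ideal_mul J I.
Proof.
have sub A B z : ideal_mul A B z -> ideal_mul B A z.
  apply: ideal_mul_ind; [exact: ideal_mul0 | exact: ideal_mulD |].
  by move=> x y Ax By; rewrite mulrC; apply: ideal_mul_in.
by apply: set_ext => z; split; apply: sub.
Qed.

Lemma ideal_mulA (I J M : algC -> Prop) :
  ideal_mul I (ideal_mul J M) = ideal_mul (ideal_mul I J) M.
Proof.
have sub A B C z : ideal_mul A (ideal_mul B C) z -> ideal_mul (ideal_mul A B) C z.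
  apply: ideal_mul_ind; [exact: ideal_mul0 | exact: ideal_mulD |].
  move=> x y Ax; move: y; apply: ideal_mul_ind => [|y y'|y y' By Cy'].
  - by rewrite mulr0; apply: ideal_mul0.
  - by rewrite mulrDr; apply: ideal_mulD.
  - by rewrite mulrA; apply: ideal_mul_in; first apply: ideal_mul_in.
apply: set_ext => z; split; first exact: sub.
(* The reverse inclusion is the first one read through commutativity. *)
rewrite ideal_mulC (ideal_mulC I J) => /sub.
by rewrite ideal_mulC (ideal_mulC M J).
Qed.

Lemma ideal_mul_scale (c : algC) (I J : algC -> Prop) :
  ideal_mul (scale_set c I) J = scale_set c (ideal_mul I J).
Proof.
apply: set_ext => z; split.
  move: z; apply: ideal_mul_ind.
  - by exists 0; rewrite ?mulr0 //; apply: ideal_mul0.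
  - move=> _ _ [x Ix ->] [y Iy ->].
    by exists (x + y); rewrite ?mulrDr //; apply: ideal_mulD.
  - move=> _ y [x Ix ->] Jy.
    by exists (x * y); rewrite ?mulrA //; apply: ideal_mul_in.
case=> x IJx ->; move: x IJx; apply: ideal_mul_ind.
- by rewrite mulr0; apply: ideal_mul0.
- by move=> x y; rewrite mulrDr; apply: ideal_mulD.
- by move=> x y Ix Jy; rewrite mulrA; apply: ideal_mul_in => //; exists x.
Qed.

Section Ideals.

Variable p : nat.
Hypothesis p_prime : prime p.

Local Notation K := (imagQuadField p).
Local Notation O := (ringOfIntegers p).
Local Notation s := (sqrtC (- p%:R) : algC).

Lemma is_ideal_integers : is_ideal p O.
Proof.
split=> //; [exact: integer0 | exact: integerD | exact: integerM].
Qed.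

Lemma is_nonzero_ideal_integers : is_nonzero_ideal p O.
Proof.
split; first exact: is_ideal_integers.
by exists 1; [apply: integer1 | apply/eqP/oner_neq0].
Qed.

Lemma is_ideal_conj (I : algC -> Prop) : is_ideal p I -> is_ideal p (conj_set I).
Proof.
move=> [IO I0 ID IM]; split=> [x /IO /(integer_conj p_prime)||x y Ix Iy|a x aO Ix].
- by rewrite conjCK.
- by rewrite /conj_set rmorph0.
- by rewrite /conj_set rmorphD; apply: ID.
- by rewrite /conj_set rmorphM; apply: IM => //; apply: integer_conj.
Qed.

Lemma is_nonzero_ideal_conj (I : algC -> Prop) :
  is_nonzero_ideal p I -> is_nonzero_ideal p (conj_set I).
Proof.
move=> [Iid [x Ix /eqP x0]]; split; first exact: is_ideal_conj.
by exists x^*; [rewrite /conj_set conjCK | apply/eqP; rewrite fmorph_eq0].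
Qed.

Lemma is_ideal_mul (I J : algC -> Prop) :
  is_ideal p I -> is_ideal p J -> is_ideal p (ideal_mul I J).
Proof.
move=> [IO I0 ID IM] [JO J0 JD JM]; split.
- apply: ideal_mul_ind; [exact: integer0 | exact: integerD |].
  by move=> x y /IO xO /JO yO; apply: integerM.
- exact: ideal_mul0.
- exact: ideal_mulD.
- move=> a x aO; move: x; apply: ideal_mul_ind => [|x y|x y Ix Jy].
  + by rewrite mulr0; apply: ideal_mul0.
  + by rewrite mulrDr; apply: ideal_mulD.
  + by rewrite mulrA; apply: ideal_mul_in => //; apply: IM.
Qed.

Lemma is_nonzero_ideal_mul (I J : algC -> Prop) :
  is_nonzero_ideal p I -> is_nonzero_ideal p J -> is_nonzero_ideal p (ideal_mul I J).
Proof.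
move=> [Iid [x Ix /eqP x0]] [Jid [y Jy /eqP y0]]; split; first exact: is_ideal_mul.
by exists (x * y); [apply: ideal_mul_in | apply/eqP; rewrite mulf_neq0].
Qed.

Lemma is_nonzero_ideal_scale (c : algC) (I : algC -> Prop) :
  O c -> c != 0 -> is_nonzero_ideal p I -> is_nonzero_ideal p (scale_set c I).
Proof.
move=> cO c0 [[IO I0 ID IM] [x Ix /eqP x0]]; split.
  split.
  - by move=> _ [y /IO yO ->]; apply: integerM.
  - by exists 0; rewrite ?mulr0.
  - move=> _ _ [y Iy ->] [z Iz ->]; exists (y + z); rewrite ?mulrDr //; exact: ID.
  - move=> a _ aO [y Iy ->]; exists (a * y); rewrite 1?mulrCA //; exact: IM.
by exists (c * x); [exists x | apply/eqP; rewrite mulf_neq0].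
Qed.

Lemma ideal_mul1 (I : algC -> Prop) : is_ideal p I -> ideal_mul I O = I.
Proof.
move=> [IO I0 ID IM]; apply: set_ext => z; split.
  by move: z; apply: ideal_mul_ind => // x y Ix yO; rewrite mulrC; apply: IM.
by move=> Iz; rewrite -[z]mulr1; apply: ideal_mul_in => //; apply: integer1.
Qed.

Lemma is_ideal_exp (I : algC -> Prop) n : is_ideal p I -> is_ideal p (ideal_exp p I n).
Proof.
move=> Iid; elim: n => [|n IHn] /=; first exact: is_ideal_integers.
exact: is_ideal_mul.
Qed.

(** One multiplier [c = a / b] in the field replaces the two integers of the definition; conversely
    a positive integer clears the denominator of [c]. *)
Lemma same_classP (I J : algC -> Prop) :
  same_class p I J <-> exists c, [/\ K c, c != 0 & J = scale_set c I].
Proof.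
split=> [[a [b [[aK _] [bK _] /eqP a0 /eqP b0 ab]]]|[c [cK c0 ->]]].
  exists (b^-1 * a); split; rewrite ?mulf_neq0 ?invr_eq0 //.
    by apply: fieldM => //; exact: fieldV.
  apply: (scale_set_inj b0); rewrite scale_setM mulrA mulfV // mul1r.
  by apply: set_ext => z; exact: iff_sym (ab z).
have [n n0 cO] := field_clear_denom p_prime cK.
have nC : n%:R != 0 :> algC by rewrite pnatr_eq0 -lt0n.
exists (n%:R * c), n%:R; split=> //.
- by apply: integer_int; rewrite rpred_nat.
- by apply/eqP; rewrite mulf_neq0.
- exact/eqP.
by move=> z; rewrite -/(scale_set _ _ z) -/(scale_set _ _ z) scale_setM.
Qed.

Lemma same_class_refl (I : algC -> Prop) : same_class p I I.
Proof.
apply/same_classP; exists 1; rewrite scale_set1 oner_eq0; split=> //.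
by apply: field_Crat; rewrite rpred1.
Qed.

Lemma same_class_sym (I J : algC -> Prop) : same_class p I J -> same_class p J I.
Proof.
move=> /same_classP[c [cK c0 ->]]; apply/same_classP; exists c^-1.
by rewrite scale_setM mulVf // scale_set1 invr_eq0; split=> //; exact: fieldV.
Qed.

Lemma same_class_trans (I J M : algC -> Prop) :
  same_class p I J -> same_class p J M -> same_class p I M.
Proof.
move=> /same_classP[c [cK c0 ->]] /same_classP[d [dK d0 ->]]; apply/same_classP.
exists (d * c); rewrite scale_setM mulf_neq0 //; split=> //; exact: fieldM.
Qed.

Lemma same_class_mul (A I J : algC -> Prop) :
  same_class p I J -> same_class p (ideal_mul A I) (ideal_mul A J).
Proof.
move=> /same_classP[c [cK c0 ->]]; apply/same_classP; exists c; split=> //.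
by rewrite !(ideal_mulC A) ideal_mul_scale.
Qed.

Lemma same_class_conj (I J : algC -> Prop) :
  same_class p I J -> same_class p (conj_set I) (conj_set J).
Proof.
move=> /same_classP[c [cK c0 ->]]; apply/same_classP; exists c^*.
by rewrite conj_set_scale fmorph_eq0; split=> //; exact: field_conj.
Qed.

(** The rational integers in [M] form an ideal of the integers, so Euclidean division by the least
    positive one leaves no remainder. *)
Lemma integers_min_gen (M : algC -> Prop) (m : nat) :
  (forall x y, M x -> M y -> M (x + y)) ->
  (forall a x, O a -> M x -> M (a * x)) -> (0 < m)%N -> M m%:R ->
  exists g : nat, [/\ (0 < g)%N, M g%:R
    & forall u, u \in Num.int -> M u -> exists2 k, k \in Num.int & u = k * g%:R].
Proof.
move=> MD MM m0 Mm.
have exg : exists g : nat, (0 < g)%N && `[< M g%:R >].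
  by exists m; rewrite m0; apply/asboolP.
have [g /andP[g0 /asboolP Mg] g_min] := ex_minnP exg.
exists g; split=> // u /intrP[z ->] Mz.
exists (z %/ g)%Z%:~R; first exact: intr_int.
have zE : z = (z %/ g)%Z * g + (z %% g)%Z by apply: divz_eq.
have r0 : 0 <= (z %% g)%Z by apply: modz_ge0; rewrite -lt0n.
have rg : (z %% g)%Z < g by apply: ltz_pmod; rewrite ltz_nat.
have rE : (z %% g)%Z = (`|(z %% g)%Z|%N : int) by rewrite gez0_abs.
have zC : z%:~R = (z %/ g)%Z%:~R * g%:R + `|(z %% g)%Z|%N%:R :> algC.
  by rewrite [in LHS]zE rmorphD rmorphM /= [X in _ + X%:~R]rE.
have Mr : M `|(z %% g)%Z|%N%:R.
  have -> : `|(z %% g)%Z|%N%:R = z%:~R + (- (z %/ g)%Z%:~R) * g%:R :> algC.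
    by rewrite zC; ring.
  apply: MD => //; apply: MM => //; apply: integer_int.
  by rewrite rpredN intr_int.
have : `|(z %% g)%Z|%N = 0%N.
  apply/eqP; apply: contraLR rg; rewrite -lt0n => r_gt0.
  rewrite -leNgt rE lez_nat; apply: g_min; rewrite r_gt0; exact/asboolP.
by move/eqP; rewrite absz_eq0 => /eqP rz; rewrite zC rz addr0.
Qed.

Lemma norm_nat (x : algC) : O x -> exists n : nat, x * x^* = n%:R.
Proof.
move=> xO; have /natrP[n nE] : x * x^* \in Num.nat; last by exists n.
by rewrite natrEint (int_norm p_prime xO) mul_conjC_ge0.
Qed.

(** The norm of a nonzero element is such an integer. *)
Lemma nonzero_ideal_nat (I : algC -> Prop) :
  is_nonzero_ideal p I -> exists2 m : nat, (0 < m)%N & I m%:R.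
Proof.
move=> [[IO I0 ID IM] [x Ix /eqP x0]].
have [m mE] := norm_nat (IO _ Ix); exists m.
  by rewrite lt0n -(@pnatr_eq0 algC) -mE norm_eq0.
rewrite -mE mulrC; apply: IM => //; apply: integer_conj => //; exact: IO.
Qed.

(* Instead of generators of [I], the proof uses the least positive integer [g]
   of the product: [g] divides the norm of every element of [I], and
   by polarization the trace of [x y^*] too, while [g^2] divides its norm. *)
Lemma ideal_mul_conj (I : algC -> Prop) : is_nonzero_ideal p I ->
  exists2 g : nat, (0 < g)%N & ideal_mul I (conj_set I) = scale_set g%:R O.
Proof.
move=> Inz; have Mnz := is_nonzero_ideal_mul Inz (is_nonzero_ideal_conj Inz).
have [m m0 Mm] := nonzero_ideal_nat Mnz.
case: (Mnz) => [[MO M0 MD MM] _].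
have [g [g0 Mg gP]] := integers_min_gen MD MM m0 Mm.
have gC : g%:R != 0 :> algC by rewrite pnatr_eq0 -lt0n.
exists g => //; case: Inz => [[IO I0 ID IM] _].
have nP x : I x -> exists2 k, k \in Num.int & x * x^* = k * g%:R.
  move=> Ix; apply: gP; first exact: (int_norm p_prime (IO _ Ix)).
  by apply: ideal_mul_in => //; rewrite /conj_set conjCK.
apply: set_ext => z; split; last first.
  by move=> [x xO ->]; rewrite mulrC; apply: MM.
move: z; apply: ideal_mul_ind.
- by exists 0; rewrite ?mulr0 //; apply: integer0.
- move=> _ _ [x xO ->] [y yO ->]; exists (x + y); rewrite ?mulrDr //.
  exact: integerD.
move=> x y Ix Iy; rewrite /conj_set in Iy.
apply/(scale_setP _ _ gC).
have [k kZ kE] := nP _ Ix; have [l lZ lE] := nP _ Iy.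
have [n nZ nE] := nP _ (ID _ _ Ix Iy).
have [xK _] := IO _ Ix; have [yK _] := IO _ Iy.
rewrite conjCK in lE; rewrite rmorphD /= conjCK in nE.
have yK' : K y by rewrite -[y]conjCK; apply: field_conj.
have gcj : (g%:R^-1)^* = g%:R^-1 :> algC by rewrite fmorphV rmorph_nat.
apply: integer_trace_norm => //.
- by apply: fieldM; [apply: field_Crat; rewrite rpredV rpred_nat | apply: fieldM].
- rewrite !rmorphM /= gcj.
  have -> : g%:R^-1 * (x * y) + g%:R^-1 * (x^* * y^*) =
     ((x + y^*) * (x^* + y) - x * x^* - y^* * y) / g%:R by ring.
  rewrite nE kE lE -!mulrBl mulfK //; by rewrite !rpredB.
- rewrite !rmorphM /= gcj.
  have -> : g%:R^-1 * (x * y) * (g%:R^-1 * (x^* * y^*)) =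
     (x * x^*) * (y^* * y) * (g%:R^-1 * g%:R^-1) by ring.
  rewrite kE lE.
  have -> : k * g%:R * (l * g%:R) * (g%:R^-1 * g%:R^-1) = k * l by field.
  exact: rpredM.
Qed.

(** The conjugate ideal represents the inverse class. *)
Lemma same_class_mul_conj (I : algC -> Prop) :
  is_nonzero_ideal p I -> same_class p (ideal_mul I (conj_set I)) O.
Proof.
move=> /ideal_mul_conj[g g0 ->]; apply/same_class_sym/same_classP.
exists g%:R; split=> //; last by rewrite pnatr_eq0 -lt0n.
by apply: field_Crat; rewrite rpred_nat.
Qed.

(** Up to class, multiplying by the conjugate of [A] undoes multiplying by [A]. *)
Lemma same_class_cancel (A I J : algC -> Prop) :
  is_nonzero_ideal p A -> is_ideal p I -> is_ideal p J ->
  same_class p (ideal_mul A I) (ideal_mul A J) -> same_class p I J.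
Proof.
move=> Anz Iid Jid /(same_class_mul (conj_set A)).
have AA M : is_ideal p M ->
    same_class p (ideal_mul (conj_set A) (ideal_mul A M)) M.
  move=> Mid; rewrite ideal_mulA (ideal_mulC (conj_set A)) ideal_mulC.
  rewrite -[X in same_class _ _ X](ideal_mul1 Mid).
  by apply/same_class_mul/same_class_mul_conj.
move=> AIJ; apply: same_class_trans (same_class_sym (AA _ Iid)) _.
exact: same_class_trans AIJ (AA _ Jid).
Qed.

End Ideals.

(** * Conjugation-invariant classes and class orders *)

Section ClassGroup.

Variable p : nat.
Hypothesis p_prime : prime p.
Hypothesis p_mod4 : (p %% 4 = 3)%N.

Local Notation K := (imagQuadField p).
Local Notation O := (ringOfIntegers p).
Local Notation s := (sqrtC (- p%:R) : algC).
Local Notation omega := ((1 + s) / 2%:R).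

(** Traces of elements of [J] are integers in [J], hence multiples of [n]. Let [u], [w], [k] be the
    traces of [x], [s * x], [omega * x] divided by [n]. Then [w = 2 k - u] because
    [s = 2 omega - 1], and [s / n * x = (w + u * s) / 2] has trace [w] and norm [(w^2 + p u^2) / 4],
    an integer because [w] and [u] have the same parity and 4 divides [1 + p]. *)
Lemma conj_invariant_sub_sqrtN (J : algC -> Prop) (n : nat) :
  is_ideal p J -> conj_set J = J -> (0 < n)%N ->
  (forall u, u \in Num.int -> J u -> exists2 k, k \in Num.int & u = k * n%:R) ->
  forall x, J x -> O (s / n%:R * x).
Proof.
move=> [JO J0 JD JM] JJ n0 nP x Jx; have xO := JO _ Jx.
have nC : n%:R != 0 :> algC by rewrite pnatr_eq0 -lt0n.
have trP y : J y -> exists2 k, k \in Num.int & y + y^* = k * n%:R.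
  move=> Jy; apply: nP; first exact: (int_trace p_prime (JO _ Jy)).
  by apply: JD => //; rewrite -JJ /conj_set conjCK.
have [u uZ uE] := trP _ Jx.
have [w wZ wE] := trP _ (JM _ _ (integer_sqrtN p_prime) Jx).
have [k kZ kE] := trP _ (JM _ _ (integer_omega p_prime p_mod4) Jx).
rewrite rmorphM /= conj_sqrtN // in wE.
rewrite rmorphM /= conj_omega // in kE.
have wkE : w = 2%:R * k - u.
  apply: (mulIf nC); rewrite mulrBl -mulrA -kE -wE -uE.
  by field; rewrite ?pnatr_eq0.
have [l [lZ lE]] : exists l, l \in Num.int /\ 1 + p%:R = 4%:R * l :> algC.
  exists (p.+1 %/ 4)%N%:R; split; first exact: rpred_nat.
  rewrite -natrM -[1]/(1%:R) -natrD; congr (_%:R); lia.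
have yE : s / n%:R * x = (w + u * s) / 2%:R.
  have -> : w = (s * x - s * x^*) / n%:R by rewrite -mulNr wE mulfK.
  have -> : u = (x + x^*) / n%:R by rewrite uE mulfK.
  by field; rewrite ?nC ?pnatr_eq0.
have wQ : w \in Crat by case/intrP: wZ => i ->; rewrite rpred_int.
have uQ : u \in Crat by case/intrP: uZ => i ->; rewrite rpred_int.
have ycE : (s / n%:R * x)^* = (w - u * s) / 2%:R.
  by rewrite yE rmorphM /= conj_field // fmorphV rmorph_nat.
apply: integer_trace_norm => //.
- apply: fieldM; last by case: xO.
  apply: fieldM; first exact: field_sqrtN.
  by apply: field_Crat; rewrite rpredV rpred_nat.
- rewrite ycE yE; have -> : (w + u * s) / 2%:R + (w - u * s) / 2%:R = w.
    by field; rewrite ?pnatr_eq0.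
  by [].
- rewrite ycE yE.
  have -> : (w + u * s) / 2%:R * ((w - u * s) / 2%:R) =
    (w * w - u * u * (s * s)) / 4%:R by field; rewrite ?pnatr_eq0.
  rewrite sqrtN_sqr wkE.
  have -> : p%:R = 4%:R * l - 1 by rewrite -lE; ring.
  have -> : ((2%:R * k - u) * (2%:R * k - u) - u * u * - (4%:R * l - 1)) / 4%:R
     = k * k - k * u + u * u * l by field; rewrite ?pnatr_eq0.
  by rewrite rpredD ?rpredB ?rpredM.
Qed.

(** Scaling by [s / n] gives an ideal [A] of the same class between [s O] and [O]. Instead of the
    quotient of [O] by [s O], the argument looks at the least positive integer in [A], which divides
    [p]. *)
Lemma conj_invariant_principal (J : algC -> Prop) :
  is_nonzero_ideal p J -> conj_set J = J -> same_class p J O.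
Proof.
move=> Jnz JJ; have [m m0 Jm] := nonzero_ideal_nat p_prime Jnz.
case: Jnz => Jid _; case: (Jid) => JO J0 JD JM.
have [n [n0 Jn nP]] := integers_min_gen JD JM m0 Jm.
have nC : n%:R != 0 :> algC by rewrite pnatr_eq0 -lt0n.
have s0 := sqrtN_neq0 p_prime.
have sn0 : s / n%:R != 0 by rewrite mulf_neq0 ?invr_eq0.
have snK : K (s / n%:R).
  apply: fieldM; first exact: field_sqrtN.
  by apply: field_Crat; rewrite rpredV rpred_nat.
pose A := scale_set (s / n%:R) J.
have AO z : A z -> O z.
  by move=> [x Jx ->]; exact: (conj_invariant_sub_sqrtN Jid JJ n0 nP Jx).
have AD x y : A x -> A y -> A (x + y).
  by move=> [x' Jx ->] [y' Jy ->]; exists (x' + y'); [apply: JD | rewrite mulrDr].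
have AM a x : O a -> A x -> A (a * x).
  by move=> aO [x' Jx ->]; exists (a * x'); [apply: JM | rewrite mulrCA].
have As : A s by exists n%:R; rewrite ?mulfVK.
have JA : same_class p J A by apply/same_classP => //; exists (s / n%:R).
apply: same_class_trans JA _ => //.
have [AsO|[x Ax xs]] : (forall x, A x -> O (s^-1 * x)) \/ (exists2 x, A x & ~ O (s^-1 * x)).
  case: (pselect (forall x, A x -> O (s^-1 * x))) => [|/existsNP[x /not_implyP[Ax xs]]].
    by left.
  by right; exists x.
- have -> : A = scale_set s O.
    apply: set_ext => z; split=> [Az|[x xO ->]].
      by apply/scale_setP => //; apply: AsO.
    by rewrite mulrC; apply: AM.
  apply: same_class_sym => //; apply/same_classP => //; exists s; split=> //.
  exact: field_sqrtN.
(* Some [x] in [A] lies outside [s O], and [A] must be the whole ring. *)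
- suff A1 : A 1.
    have -> : A = O; last exact: same_class_refl.
    apply: set_ext => z; split=> [/AO //|zO].
    by rewrite -[z]mulr1; apply: AM.
  have Ap : A p%:R.
    have -> : p%:R = (- s) * s by rewrite mulNr sqrtN_sqr opprK.
    by apply: AM => //; apply: integerN; apply: integer_sqrtN.
  have [g [g0 Ag gP]] := integers_min_gen AD AM (prime_gt0 p_prime) Ap.
  have gC : g%:R != 0 :> algC by rewrite pnatr_eq0 -lt0n.
  have [k kZ kE] := gP _ (rpred_nat _ _) Ap.
  have /natrP[q qE] : k \in Num.nat.
    by rewrite natrEint kZ -(mulfK gC k) -kE divr_ge0 ?ler0n.
  move: kE; rewrite qE -natrM => /eqP; rewrite eqr_nat => /eqP pE.
  have gp : (g %| p)%N by rewrite pE dvdn_mull.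
  have xO := AO _ Ax.
  have xc : A (x * x^*).
    by rewrite mulrC; apply: AM => //; apply: integer_conj.
  have [l lZ lE] := gP _ (int_norm p_prime xO) xc.
  case/primeP: p_prime => _ /(_ _ gp) /pred2P[g1|gp1]; first by rewrite g1 in Ag.
  (* If the least positive integer is [p], then [s^-1 * x] has trace [v] and norm [l], so it is
     integral, against the choice of [x]. *)
  have [v vZ vE] := integer_im p_prime xO.
  case: xs; apply: integer_trace_norm => //.
  + by apply: fieldM; [apply/fieldV => //; apply: field_sqrtN | case: xO].
  + rewrite rmorphM fmorphV /= conj_sqrtN // invrN mulNr -mulrBr vE.
    by rewrite mulrC mulfK.
  + rewrite rmorphM fmorphV /= conj_sqrtN //.
    have -> : s^-1 * x * ((- s)^-1 * x^*) = (x * x^*) / - (s * s).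
      by field; rewrite ?oppr_eq0.
    by rewrite lE sqrtN_sqr opprK gp1 mulfK // natr_prime_neq0.
Qed.

Lemma conj_class_principal (I : algC -> Prop) :
  is_nonzero_ideal p I -> same_class p I (conj_set I) -> same_class p I O.
Proof.
move=> Inz /same_classP -/(_ p_prime)[c [cK c0 cE]].
have [g g0 gE] := ideal_mul_conj p_prime Inz.
have gC : g%:R != 0 :> algC by rewrite pnatr_eq0 -lt0n.
have IE : I = scale_set (c * c^*) I.
  by rewrite -[LHS]conj_setK cE conj_set_scale {1}cE scale_setM mulrC.
(* Multiply [I = c c^* I] by the conjugate of [I], which turns [I] into [g O], and cancel [g]. *)
have ccO : O = scale_set (c * c^*) O.
  by apply: (scale_set_inj gC); rewrite scale_setM mulrC -scale_setM -gE
    -ideal_mul_scale -IE.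
have cc1 : c * c^* = 1.
  (* The norm of [c] and its inverse [y] are both rational, integral and nonnegative: two natural
     numbers with product 1. *)
  have ccZ : c * c^* \in Num.int.
    apply: Cint_rat_Aint; first exact: (Crat_norm p_prime cK).
    suff [] : O (c * c^*) by [].
    by rewrite ccO; exists 1; rewrite ?mulr1 //; apply: integer1.
  have [y [yK yA] yE] : scale_set (c * c^*) O 1 by rewrite -ccO; apply: integer1.
  have cc0 : c * c^* != 0 by rewrite norm_eq0.
  have yI : y = (c * c^*)^-1 by rewrite -[LHS](mulKf cc0) -yE mulr1.
  have yZ : y \in Num.int.
    by apply: Cint_rat_Aint => //; rewrite yI rpredV (Crat_norm p_prime cK).
  have /natrP[a aE] : c * c^* \in Num.nat by rewrite natrEint ccZ mul_conjC_ge0.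
  have /natrP[b bE] : y \in Num.nat.
    by rewrite natrEint yZ yI invr_ge0 mul_conjC_ge0.
  move: yE; rewrite aE bE -natrM => /eqP; rewrite eq_sym pnatr_eq1 muln_eq1.
  by case/andP=> /eqP ->.
(* Hilbert 90 *)
have [e [eO e0 ee]] : exists e, [/\ O e, e != 0 & e^* * c = e].
  (* The solution [e = n * (1 + c)] vanishes when [c = -1], where [s] serves instead. *)
  have [c1|c1] := eqVneq c (-1).
    exists s; split; [exact: integer_sqrtN | exact: sqrtN_neq0 |].
    by rewrite conj_sqrtN // c1 mulrN1 opprK.
  have [n n0 nO] := field_clear_denom p_prime cK.
  exists (n%:R + n%:R * c); split.
  - by apply: integerD => //; apply: integer_int; rewrite rpred_nat.
  - rewrite -[X in X + _]mulr1 -mulrDr mulf_neq0 ?pnatr_eq0 -?lt0n //.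
    by rewrite addrC addr_eq0.
  - rewrite rmorphD rmorphM /= rmorph_nat mulrDl -mulrA (mulrC c^*) cc1 mulr1.
    by rewrite addrC.
have eI : conj_set (scale_set e I) = scale_set e I.
  by rewrite conj_set_scale cE scale_setM ee.
have := conj_invariant_principal (is_nonzero_ideal_scale eO e0 Inz) eI.
apply: same_class_trans => //; apply/same_classP => //.
by exists e; split=> //; case: eO.
Qed.

(** * Counting ideal classes by orbits *)

Lemma order_eqP (T : finType) (f : T -> T) (x : T) (n : nat) :
  injective f -> (0 < n)%N -> iter n f x = x ->
  (forall m, (0 < m < n)%N -> iter m f x <> x) -> order f x = n.
Proof.
move=> f_inj n0 fn n_min; apply/eqP; rewrite eqn_leq; apply/andP; split.
  (* Otherwise the orbit, which lists no element twice, would contain [x] at positions 0 and [n]. *)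
  rewrite leqNgt; apply/negP => n_lt.
  have := orbit_uniq f x; rewrite /orbit => /(nth_uniq x) => /(_ 0%N n).
  rewrite size_traject order_gt0 n_lt !nth_traject ?order_gt0 //= fn eqxx.
  by case: (n) n0 => // k _ /(_ isT isT).
rewrite leqNgt; apply/negP => lt_n.
by apply: (n_min (order f x)); [rewrite order_gt0 | rewrite iter_order].
Qed.

(** The index set ['I_h] stands for the class group. Conjugation induces an involution [c] on it
    that fixes only the index [i0] of the trivial class. *)
Lemma class_number_odd (h : nat) : is_class_number p h -> odd h.
Proof.
move=> [R [Rnz R_inj R_all]].
have [c cP] := choice (fun i => R_all _ (is_nonzero_ideal_conj p_prime (Rnz i))).
have [i0 i0P] := R_all _ (is_nonzero_ideal_integers p).
have cK : involutive c.
  move=> i; apply: R_inj; apply: same_class_trans => //.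
    by apply: same_class_sym => //; apply: cP.
  have := same_class_conj p_prime (cP i); rewrite conj_setK.
  exact: same_class_sym.
have fixP i : (c i == i) = (i == i0).
  apply/eqP/eqP => [ci|->].
    apply: R_inj; apply: same_class_trans (i0P) => //.
    apply: conj_class_principal => //; apply: same_class_sym => //.
    by have := cP i; rewrite ci.
  apply: R_inj; apply: same_class_trans => //.
    by apply: same_class_sym => //; apply: cP.
  have := same_class_conj p_prime i0P.
  have -> : conj_set O = O.
    apply: set_ext => z; split=> zO; last exact: integer_conj.
    by rewrite -[z]conjCK; apply: integer_conj.
  by move=> cO; apply: same_class_trans i0P => //; apply: same_class_sym.
(* The other [h - 1] indices split into orbits of length 2. *)
have := @fcard_order_set _ c (inv_inj cK) 2%N (predC1 i0).
rewrite cardC1 card_ord.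
have h0 : (0 < h)%N by apply: leq_ltn_trans (ltn_ord i0).
move=> hE; rewrite -(prednK h0) /= -hE ?oddM ?andbF //.
  apply/fintype.subsetP => i; rewrite !inE => i_i0; apply/eqP.
  apply: order_eqP => //; [exact: inv_inj | exact: cK|].
  by case=> [|[|m]] //= _; apply/eqP; rewrite fixP.
by move=> i _ /eqP <-; rewrite !inE -!fixP cK eq_sym.
Qed.

(** Multiplication by [P] induces a permutation [f] of the indices. By cancellation [iter n f] fixes
    an index exactly when the [n]-th power of [P] is principal, so every orbit has length [L]. *)
Lemma class_order_dvdn (h L : nat) (P : algC -> Prop) :
  is_class_number p h -> is_nonzero_ideal p P -> is_class_order p P L ->
  (L %| h)%N.
Proof.
move=> [R [Rnz R_inj R_all]] Pnz [L0 PL L_min].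
have Rid i : is_ideal p (R i) by case: (Rnz i).
have Pid : is_ideal p P by case: Pnz.
have [f fP] := choice (fun i => R_all _ (is_nonzero_ideal_mul Pnz (Rnz i))).
have f_inj : injective f.
  move=> i j fij; apply: R_inj; apply: (same_class_cancel p_prime Pnz) => //.
  apply: same_class_trans (fP i) _ => //; rewrite fij.
  by apply: same_class_sym.
have fnP n i : same_class p (ideal_mul (ideal_exp p P n) (R i)) (R (iter n f i)).
  elim: n => [|n IHn] /=; first by rewrite ideal_mulC ideal_mul1 //; apply: same_class_refl.
  rewrite -ideal_mulA; apply: same_class_trans (fP _) => //.
  exact: same_class_mul.
have fixP n i : iter n f i = i <-> same_class p (ideal_exp p P n) O.
  have PnR := fnP n i; split=> [fi|PO].
    rewrite fi in PnR; apply: (same_class_cancel p_prime (Rnz i)).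
    - exact: is_ideal_exp.
    - exact: is_ideal_integers.
    - by rewrite ideal_mul1 // ideal_mulC.
  apply: R_inj; apply: same_class_trans (same_class_sym _ PnR) _ => //.
  rewrite ideal_mulC -[X in same_class _ _ X](ideal_mul1 (Rid i)).
  exact: same_class_mul.
suff <- : (fcard f predT * L = h)%N by apply: dvdn_mull.
rewrite fcard_order_set ?cardT ?size_enum_ord //.
apply/fintype.subsetP => i _; rewrite inE; apply/eqP/order_eqP => //.
  exact/fixP.
by move=> m m_L /fixP; apply: L_min.
Qed.

(** This rules out [L = 1]. A generator [a] divides 2, so its norm [m] divides 4. *)
Lemma prime_above_2_not_principal (P : algC -> Prop) :
  (p %% 8 = 7)%N -> (7 < p)%N -> is_prime_ideal p P -> P 2%:R -> ~ same_class p P O.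
Proof.
move=> p8 p_gt7 [[PO P0 PD PM] P1 Pprime] P2 /(same_class_sym p_prime).
move=> /same_classP-/(_ p_prime)[a [aK a0 PE]].
have Pa : P a by rewrite PE; exists 1; rewrite ?mulr1 //; apply: integer1.
have aO := PO _ Pa.
have [b bO abE] : scale_set a O 2%:R by rewrite -PE.
have [m mE] := norm_nat p_prime aO; have [n nE] := norm_nat p_prime bO.
have mn : (m * n)%N = 4%N.
  apply/eqP; rewrite -(eqr_nat algC) natrM -mE -nE; apply/eqP.
  have -> : a * a^* * (b * b^*) = (a * b) * (a * b)^* by rewrite rmorphM /=; ring.
  by rewrite -abE rmorph_nat -natrM.
have [m1|[m2|[m4 n1]]] : m = 1%N \/ m = 2%N \/ m = 4%N /\ n = 1%N.
  have m_le : (m <= 4)%N by rewrite dvdn_leq // -mn dvdn_mulr.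
  by case: m {mE} m_le mn => [|[|[|[|[|m]]]]] //; lia.
- by apply: P1; rewrite -[1]/(1%:R) -m1 -mE mulrC; apply: PM => //; apply: integer_conj.
(* Norm 2: with trace [t] and [a - a^* = v * s], the discriminant identity reads [t^2 + p v^2 = 8].
   Since 8 is not a square, [v] is nonzero, and then [p > 8] is too large. *)
- have /intrP[t tE] := int_trace p_prime aO.
  have [_ /intrP[v ->] vE] := integer_im p_prime aO.
  have : t * t + p%:Z * (v * v) = 8.
    apply: (@intr_inj algC); rewrite rmorphD !rmorphM /= -tE.
    have -> : (a + a^*) * (a + a^*) = 4%:R * (a * a^*) + (a - a^*) * (a - a^*) by ring.
    rewrite mE vE m2 mulrACA sqrtN_sqr -pmulrn.
    by rewrite mulrN (mulrC p%:R) addrNK -natrM.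
  have := sqr_ge0 t; have := sqr_ge0 v; rewrite !expr2.
  have [->|v0] := eqVneq v 0; first rewrite !mulr0 addr0.
    move=> _ _ tt; have [t_le le_t] : t <= 2 /\ -2 <= t by nia.
    have : t = -2 \/ t = -1 \/ t = 0 \/ t = 1 \/ t = 2 by lia.
    by move: tt => /[swap] => -[->|[->|[->|[->|->]]]].
  have : 0 < v * v by rewrite -expr2 exprn_even_gt0.
  move=> *; nia.
(* Norm 4: the cofactor [b] is a unit, so [P] lies in [2 O], which contains no element of trace
   1. *)
- have bb1 : b * b^* = 1 by rewrite nE n1.
  have PE2 z : P z -> O (z / 2%:R).
    rewrite PE => -[x xO ->].
    have -> : a * x / 2%:R = b^* * x.
      rewrite abE; have b0 : b != 0 by rewrite -norm_eq0 bb1 oner_neq0.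
      have -> : b^* = b^-1 by rewrite -[LHS](mulKf b0) bb1 mulr1.
      by field; rewrite a0 b0.
    by apply: integerM => //; apply: integer_conj.
  have not_half z : z + z^* = 1 -> ~ P z.
    move=> z1 /PE2 /(int_trace p_prime).
    rewrite rmorphM fmorphV /= rmorph_nat -mulrDl z1 mul1r => /intrP[k kE].
    have : 1 = 2 * k.
      apply: (@intr_inj algC); rewrite intrM -kE mulfV //.
      by rewrite (pnatr_eq0 _ 2).
    lia.
  have wO := integer_omega p_prime p_mod4.
  (* As [p = 7] modulo 8, the norm [(p + 1) / 4] of [omega] is even; primality of [P] then puts
     [omega] or its conjugate, both of trace 1, in [P]. *)
  have Pw : P (omega * omega^*).
    rewrite norm_omega //.
    have -> : (p.+1 %/ 4 = (p.+1 %/ 8) * 2)%N by lia.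
    by rewrite natrM; apply: PM => //; apply: integer_int; rewrite rpred_nat.
  case: (Pprime _ _ wO (integer_conj p_prime wO) Pw).
    by apply: not_half; apply: trace_omega.
  by apply: not_half; rewrite conjCK addrC trace_omega.
Qed.
End ClassGroup.

Theorem mainTheorem12 (p h L : nat) (P : algC -> Prop)
  (p_prime : prime p)
  (p_mod : (p = 71 %[mod 120] \/ p = 119 %[mod 120])%N)
  (h_class_number : is_class_number p h)
  (P_prime : is_prime_ideal p P)
  (P_above_2 : P 2%:R)
  (L_order : is_class_order p P L) :
  meanDiam (Gamma h L) =
    2%:R^-1 * (L%:R + 3%:R - 4%:R * L%:R / (h%:R + L%:R)) :> rat.
Proof.
(* Both residues modulo 120 are 7 modulo 8. *)
have p_mod4 : (p %% 4 = 3)%N by lia.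
have p_mod8 : (p %% 8 = 7)%N by lia.
have p_gt7 : (7 < p)%N by lia.
have Pid : is_ideal p P by case: P_prime.
have Pnz : is_nonzero_ideal p P.
  by split=> //; exists 2%:R => //; apply/eqP; rewrite pnatr_eq0.
have h_odd := class_number_odd p_prime p_mod4 h_class_number.
have L_dvd := class_order_dvdn p_prime h_class_number Pnz L_order.
apply: meanDiam_Gamma => //.
have L_odd : odd L := dvdn_odd L_dvd h_odd.
case: L_order => L_gt0 PL _.
(* Since [L] is odd, excluding 1 leaves [2 < L]. *)
have : L <> 1%N.
  move=> L1; apply: (prime_above_2_not_principal p_prime p_mod4 p_mod8 p_gt7 P_prime).
    exact: P_above_2.
  by move: PL; rewrite L1 /= ideal_mul1.
by case: L L_odd {L_dvd L_gt0 PL} => [|[|[|]]].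
Qed.
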